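(* If $\Sigma$ is a surface of Euler characteristic at most $1$, then $\vec{\chi}(\Sigma) \geq 3$.
   Context: All surfaces are closed (and connected): each is homeomorphic either to $\mathbb{S}_k$ (the sphere with $k$ handles, Euler characteristic $2-2k$) or to $\mathbb{N}_k$ (the sphere with $k$ cross-caps, Euler characteristic $2-k$). A $k$-dicolouring of a digraph is a partition of its vertex set into $k$ subsets each inducing an acyclic subdigraph (no directed cycle); a digraph is $k$-dicolourable if it has a $k$-dicolouring. An oriented graph is a digraph obtained from a finite simple graph (its underlying graph) by replacing each edge by exactly one of the two possible arcs; it is embeddable on a surface if its underlying graph is. The dichromatic number $\vec{\chi}(\Sigma)$ of a surface $\Sigma$ is the least integer $k$ such that every oriented graph embeddable on $\Sigma$ is $k$-dicolourable. *)

(* Defs.v *)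
From HB Require Import structures.
From mathcomp Require Import all_boot all_order all_algebra.
From mathcomp Require Import lra zify.
From mathcomp Require Import all_classical all_reals all_analysis.

Set Implicit Arguments.
Unset Strict Implicit.
Unset Printing Implicit Defensive.

Import Order.TTheory GRing.Theory Num.Theory.
Import numFieldNormedType.Exports.

Local Open Scope classical_set_scope.
Local Open Scope ring_scope.

Definition homeomorphic (S T : topologicalType) : Prop :=
  exists (f : S -> T) (g : T -> S),
    [/\ cancel f g, cancel g f, continuous f & continuous g].

Section Surfaces.
Variable R : realType.

Notation plane := (R * R)%type.

(* The sphere is the one-point compactification of the plane, from which the
   open unit balls centred at the points of [C] are removed. The norm of the
   plane is the sup norm, so these topological discs are squares of side 2. *)
Definition perforated_sphere (C : set plane)
    : set (one_point_compactification plane) :=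
  ~` (Some @` \bigcup_(c in C) ball c (1 : R)).

Definition hole_center (i : nat) : plane := ((4 * i)%:R, 0).

Definition handle_center (i : nat) (b : bool) : plane :=
  ((4 * i)%:R, if b then 2 else - 2).

Definition reflect_plane (p : plane) : plane := (p.1, - p.2).

Definition crosscap_centers (k : nat) : set plane :=
  [set hole_center i | i in [set i | (i < k)%N]].

Definition handle_centers (k : nat) : set plane :=
  [set c | exists i b, (i < k)%N /\ c = handle_center i b].

(* A cross-cap: antipodal points of the boundary of a hole are identified. *)
Definition crosscap_rel (k : nat) (p q : plane) : Prop :=
  p = q \/
  exists2 c, crosscap_centers k c & `|p - c| = 1 /\ p + q = c *+ 2.

(* A handle: the boundaries of two symmetric holes are identified by a
   reflection. A reflection, as opposed to a translation, is what makes the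
   resulting surface orientable. *)
Definition handle_rel (k : nat) (p q : plane) : Prop :=
  p = q \/
  exists2 c, handle_centers k c & `|p - c| = 1 /\ q = reflect_plane p.

Definition lift_rel (r : plane -> plane -> Prop)
    (x y : one_point_compactification plane) : Prop :=
  match x, y with
  | Some p, Some q => r p q
  | None, None => True
  | _, _ => False
  end.

Section Gluing.
Variables (C : set plane) (r : plane -> plane -> Prop).
Hypotheses (r_refl : forall p, r p p) (r_sym : forall p q, r p q -> r q p).
Hypothesis r_trans : forall p q s, r p q -> r q s -> r p s.

Definition glue_rel (x y : perforated_sphere C) : bool :=
  `[< lift_rel r (set_val x) (set_val y) >].

Lemma glue_rel_equiv : equiv_class_of glue_rel.
Proof.
split.
- by move=> x; apply/asboolP; rewrite /lift_rel; case: (set_val x).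
- move=> x y; apply/asboolP/asboolP; rewrite /lift_rel;
  by case: (set_val x) (set_val y) => [p|] [q|] //; apply: r_sym.
- move=> y x z /asboolP xy /asboolP yz; apply/asboolP.
  move: xy yz; rewrite /lift_rel.
  by case: (set_val x) (set_val y) (set_val z) => [p|] [q|] [s|] //; apply: r_trans.
Qed.

Canonical glue_equiv := EquivRelPack glue_rel_equiv.

Definition glued_sphere : topologicalType :=
  quotient_topology {eq_quot glue_equiv}%qT.

End Gluing.

Lemma crosscap_refl k p : crosscap_rel k p p.
Proof. by left. Qed.

Lemma crosscap_sym k p q : crosscap_rel k p q -> crosscap_rel k q p.
Proof.
case=> [->|[c cC [pc pq]]]; first by left.
right; exists c => //; rewrite (addrC q p) pq; split=> //.
have -> : q - c = - (p - c).
  rewrite opprB; have -> : q = c *+ 2 - p by rewrite -pq addrAC subrr add0r.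
  by rewrite mulr2n addrAC addrK.
by rewrite normrN.
Qed.

Lemma hole_center_inj i j (p : plane) :
  `|p - hole_center i| = 1 -> `|p - hole_center j| = 1 -> i = j.
Proof.
move=> pi pj; have := ler_norm (p.1 - (hole_center i).1).
have := ler_norm (- (p.1 - (hole_center i).1)).
have := ler_norm (p.1 - (hole_center j).1).
have := ler_norm (- (p.1 - (hole_center j).1)).
have h i' : `|p - hole_center i'| = 1 -> `|p.1 - (hole_center i').1| <= 1.
  by move=> <-; rewrite prod_normE le_max lexx.
rewrite !normrN; move: (h _ pi) (h _ pj); rewrite /= !natrM => hi hj h1 h2 h3 h4.
case: (ltngtP i j) => // ij.
- have : (i.+1%:R : R) <= j%:R by rewrite ler_nat.
  by rewrite -natr1 => h5; exfalso; clear ij; lra.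
- have : (j.+1%:R : R) <= i%:R by rewrite ler_nat.
  by rewrite -natr1 => h5; exfalso; clear ij; lra.
Qed.

Lemma crosscap_trans k p q s :
  crosscap_rel k p q -> crosscap_rel k q s -> crosscap_rel k p s.
Proof.
move=> pq; have := crosscap_sym pq; case: pq => [->//|[_ [i ik <-] [pi pq]]].
move=> qp [<-|[_ [j jk <-] [qj qs]]].
  by right; exists (hole_center i) => //; exists i.
case: qp => [qp|[_ [l lk <-] [ql qp]]].
  right; exists (hole_center j); [by exists j|by rewrite -qp].
by left; move: qs; rewrite -(hole_center_inj ql qj) -qp => /addrI ->.
Qed.

Lemma handle_refl k p : handle_rel k p p.
Proof. by left. Qed.

Lemma reflect_planeK : involutive reflect_plane.
Proof. by case=> a b; rewrite /reflect_plane /= opprK. Qed.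

Lemma handle_sym k p q : handle_rel k p q -> handle_rel k q p.
Proof.
case=> [->|[_ [i [b [ik ->]]] [pc ->]]]; first by left.
right; exists (handle_center i (~~ b)); first by exists i, (~~ b).
split; last by rewrite reflect_planeK.
rewrite -pc !prod_normE /=; congr (Num.max _ _).
by rewrite -normrN opprD opprK; case: b {pc} => /=; rewrite ?opprK.
Qed.

Lemma handle_trans k p q s :
  handle_rel k p q -> handle_rel k q s -> handle_rel k p s.
Proof.
move=> [->//|[c cC [pc ->]]] [<-|[d dD [_ ->]]].
  by right; exists c.
by left; rewrite reflect_planeK.
Qed.

Definition sphere_with_crosscaps (k : nat) : topologicalType :=
  glued_sphere (crosscap_centers k)
    (@crosscap_refl k) (@crosscap_sym k) (@crosscap_trans k).

Definition sphere_with_handles (k : nat) : topologicalType :=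
  glued_sphere (handle_centers k)
    (@handle_refl k) (@handle_sym k) (@handle_trans k).

Definition surface_of_euler_char (Sigma : topologicalType) (chi : int) : Prop :=
  (exists k : nat,
     homeomorphic Sigma (sphere_with_handles k) /\ chi = 2 - 2 * k%:Z) \/
  (exists k : nat,
     homeomorphic Sigma (sphere_with_crosscaps k) /\ chi = 2 - k%:Z).

Definition simple_arc (T : topologicalType) (A : set T) (x y : T) : Prop :=
  exists gamma : R -> T,
    [/\ {within `[0, 1], continuous gamma},
        {in `[0, 1] &, injective gamma},
        gamma 0 = x, gamma 1 = y & gamma @` `[0, 1] = A].

Definition embeddable (V : finType) (e : rel V) (T : topologicalType) : Prop :=
  exists (p : V -> T) (A : V -> V -> set T),
    [/\ injective p,
        forall u v, A u v = A v u,
        forall u v, e u v -> simple_arc (A u v) (p u) (p v),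
        forall u v, e u v ->
          (A u v `\` [set p u; p v]) `&` range p = set0 &
        forall u v u' v', e u v -> e u' v' ->
          [set u; v]%SET != [set u'; v']%SET ->
          (A u v `\` [set p u; p v]) `&` A u' v' = set0].

End Surfaces.

Definition oriented (V : finType) (arc : rel V) : Prop :=
  forall u v, arc u v -> ~~ arc v u.

Definition underlying (V : finType) (arc : rel V) : rel V :=
  fun u v => arc u v || arc v u.

Definition acyclic_on (V : finType) (arc : rel V) (S : {set V}) : Prop :=
  forall s : seq V, s != [::] -> {subset s <= S} -> ~ ucycle arc s.

Definition dicolourable (k : nat) (V : finType) (arc : rel V) : Prop :=
  exists f : V -> 'I_k, forall i, acyclic_on arc [set v | f v == i]%SET.

Definition surface_dicolourable (R : realType) (T : topologicalType) (k : nat)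
    : Prop :=
  forall (V : finType) (arc : rel V),
    oriented arc -> embeddable R (underlying arc) T -> dicolourable k arc.

(* The least [k] as an extended real, so as not to presuppose existence: the
   infimum of a nonempty set of naturals is its minimum, and it is [+oo] when
   no [k] is suitable. *)
Definition dichromatic_number (R : realType) (T : topologicalType) : \bar R :=
  ereal_inf [set k%:R%:E | k in [set k : nat | surface_dicolourable R T k]].

(* Main.v *)
Require Import Defs.
From Stdlib Require Import ZArith.
From mathcomp Require Import all_boot all_order all_algebra.
From mathcomp Require Import all_classical all_reals all_analysis.
From mathcomp Require Import ring lra zify ssrZ.
Import Order.TTheory GRing.Theory Num.Theory.
Import numFieldNormedType.Exports.
Local Open Scope ring_scope.

(** A surface of Euler characteristic at most 1 has a handle or a cross-cap,
    so it suffices to find one oriented graph that is not 2-dicolourable and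
    that embeds on every sphere with at least one handle or one cross-cap.

    The graph. The complete graph on six vertices triangulates the projective
    plane with ten faces, and every 2-colouring of the vertices has a
    monochromatic face ([K6_faces]). If all faces were directed triangles,
    there would be no 2-dicolouring. This cannot be achieved, since the arcs
    at a vertex of odd degree cannot alternate in direction, but an
    orientation exists for which only three faces are transitive. Inside each
    of them three vertices are added so as to form an octahedron whose other
    faces prevent the outer triangle from being monochromatic
    ([gadget_spec]). The result has 15 vertices and is not 2-dicolourable
    ([arc15_not_2dicolourable]).

    The embedding. Take one of the six vertices as an apex; its neighbours
    form a pentagon. All of the graph is planar except for the five chords of
    that pentagon: everything else is drawn in the plane outside the
    pentagon. A cross-cap inside the pentagon lets the chords through,
    antipodally, without crossing. A handle inside the pentagon does so too:
    two chords which share a vertex pass between its two ends and the other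
    three run through it. Hence the same planar drawing serves for all
    surfaces, and further handles or cross-caps lie in the unbounded face.

    The verification. Every edge is cut in two straight half-edges, from each
    endpoint to a middle; for a chord through a handle or a cross-cap the two
    middles are distinct boundary points of holes that are glued together.
    That half-edges meet only where they should ([drawing_embeddable])
    follows from sign conditions on coordinates ([fan_disjoint],
    [split_disjoint], [clear_segment]), which are decided by integer
    computation and transported to the reals ([drawing_on_glued_sphere]). *)

Set Implicit Arguments.
Unset Strict Implicit.
Unset Printing Implicit Defensive.

(** * An oriented graph without 2-dicolouring *)

Section Digraph.
Local Open Scope nat_scope.

(** An octahedron on the outer triangle [a, b, c] and the inner triangle
    [x, y, z]. Each inner vertex closes one side of the outer triangle, whose
    arcs are [a -> b], [b -> c] and [a -> c], into a directed triangle, and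
    the inner triangle is directed too. *)
Definition gadget (abc : nat * nat * nat) (x : nat) : seq (nat * nat) :=
  let: (a, b, c) := abc in let y := x.+1 in let z := x.+2 in
  [:: (b, x); (x, a); (c, y); (y, b); (c, z); (z, a); (x, y); (y, z); (z, x)].

(** The vertices [0, ..., 4] carry the rotational tournament
    [i -> i + 1, i + 2] modulo 5, so that the triangles [i, i + 1, i + 3] are
    directed. The five triangles on the apex [5] and a side of the pentagon
    cannot all be directed, since the five arcs at the apex cannot alternate
    in direction: here [0, 1] and [2, 3] span directed ones, and the other
    three, which are transitive, each receive a gadget. *)
Definition arcs : seq (nat * nat) :=
  [:: (0, 1); (1, 2); (2, 3); (3, 4); (4, 0);
      (0, 2); (1, 3); (2, 4); (3, 0); (4, 1);
      (5, 0); (1, 5); (5, 2); (3, 5); (4, 5)]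
  ++ gadget (1, 5, 2) 6 ++ gadget (3, 4, 5) 9 ++ gadget (4, 5, 0) 12.

Definition arc15 : rel 'I_15 := fun u v => (val u, val v) \in arcs.

Lemma arc15_oriented : oriented arc15.
Proof.
have /allP H : all (fun a => (a.2, a.1) \notin arcs) arcs by vm_compute.
by move=> u v /H.
Qed.

Definition half_edges : seq (nat * nat) := arcs ++ [seq (a.2, a.1) | a <- arcs].

Lemma mem_swap (s : seq (nat * nat)) x y :
  ((x, y) \in [seq (a.2, a.1) | a <- s]) = ((y, x) \in s).
Proof.
apply/mapP/idP => [[[a b] h [-> ->]] //|h].
by exists (y, x).
Qed.

Lemma underlying15 (u v : 'I_15) :
  underlying arc15 u v = ((val u, val v) \in half_edges).
Proof. by apply: esym; apply: etrans (mem_cat _ _ _) _; rewrite mem_swap. Qed.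

Definition two_coloured (c : nat -> bool) (x y z : nat) : bool :=
  ~~ ((c x == c y) && (c y == c z)).

(** If [i], [j] and [k] had the same colour, each inner vertex would have to
    take the other one, and the inner triangle would be monochromatic. *)
Lemma gadget_spec (c : nat -> bool) (i j k x : nat) :
  two_coloured c j x i -> two_coloured c k x.+1 j ->
  two_coloured c k x.+2 i -> two_coloured c x x.+1 x.+2 ->
  two_coloured c i j k.
Proof.
rewrite /two_coloured.
by move: (c i) (c j) (c k) (c x) (c x.+1) (c x.+2) => [] [] [] [] [] [].
Qed.

(** The ten triples are the faces of the triangulation of the projective
    plane by the complete graph on six vertices. Of any two complementary
    triples one is a face, and any four vertices contain a face, so a set of
    vertices or its complement always does. *)
Lemma K6_faces (c : nat -> bool) :
  ~~ [&& two_coloured c 0 1 3, two_coloured c 1 2 4, two_coloured c 2 3 0,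
         two_coloured c 3 4 1, two_coloured c 4 0 2,
         two_coloured c 5 0 1, two_coloured c 1 5 2, two_coloured c 5 2 3,
         two_coloured c 3 4 5 & two_coloured c 4 5 0].
Proof.
rewrite /two_coloured.
by move: (c 0) (c 1) (c 2) (c 3) (c 4) (c 5) => [] [] [] [] [] [].
Qed.

(** Each of the ten faces is a directed triangle or the outer triangle of a
    gadget, so in a 2-dicolouring none would be monochromatic. *)
Lemma arc15_not_2dicolourable : ~ dicolourable 2 arc15.
Proof.
case=> f acyc.
pose c n := f (inord n) == ord0.
have col (u v : 'I_15) : (f u == ord0) = (f v == ord0) -> f u = f v.
  by move=> h; apply: val_inj; case: (f u) (f v) h => [[|[|?]] ?] [[|[|?]] ?].
have tri x y z : [&& (x, y) \in arcs, (y, z) \in arcs, (z, x) \in arcs &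
    [&& x < 15, y < 15, z < 15 & uniq [:: x; y; z]]] -> two_coloured c x y z.
  case/and5P=> xy yz zx xn /and3P[yn zn xyz].
  apply/negP=> /andP[/eqP /col cxy /eqP /col cyz].
  apply: (acyc (f (inord x)) [:: inord x; inord y; inord z]) => //.
    by move=> u; rewrite !inE => /or3P[] /eqP->; rewrite -?cyz -?cxy eqxx.
  have vi n : n < 15 -> val (inord n : 'I_15) = n by exact: inordK.
  rewrite /ucycle /cycle /= /arc15 !vi // xy yz zx /=.
  by rewrite !inE -!val_eqE !vi //; move: xyz; rewrite /= !inE.
apply/negP: (K6_faces c); rewrite negbK.
do !(apply/andP; split); try exact: tri.
- by apply: (@gadget_spec _ _ _ _ 6); apply: tri.
- by apply: (@gadget_spec _ _ _ _ 9); apply: tri.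
- by apply: (@gadget_spec _ _ _ _ 12); apply: tri.
Qed.

Lemma dicolourable_widen (V : finType) (arc : rel V) (k l : nat) :
  k <= l -> dicolourable k arc -> dicolourable l arc.
Proof.
move=> kl [f fk]; exists (fun v => widen_ord kl (f v)) => i s s0 si.
case: s s0 si => // x s _ si; apply: (fk (f x)) => //= y ys.
have := si _ ys; have := si _ (mem_head x s); rewrite !inE => /eqP <-.
by rewrite -val_eqE.
Qed.

End Digraph.

(** * Segments in the plane *)

Section Orientation.
Variable A : realDomainType.
Implicit Types o a b c d : A * A.

Definition cross o a b : A :=
  (a.1 - o.1) * (b.2 - o.2) - (a.2 - o.2) * (b.1 - o.1).

Definition dot o a b : A :=
  (a.1 - o.1) * (b.1 - o.1) + (a.2 - o.2) * (b.2 - o.2).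

(** A sufficient condition for the segments [o a] and [o b] to share only
    [o]: they are not collinear, or they form an obtuse angle. The second
    case is needed at the middle of a straight edge. *)
Definition fan o a b : bool := (cross o a b != 0) || (dot o a b < 0).

(** A sufficient condition for two segments to be disjoint: the line through
    one of them has both endpoints of the other strictly on the same side. It
    is also necessary unless the four points are collinear. *)
Definition split_by_line a b c d : bool :=
  (0 < cross a b c * cross a b d) || (0 < cross c d a * cross c d b).

End Orientation.

Section Segments.
Variable R : realType.
Notation plane := (R * R)%type.
Implicit Types a b c d p : plane.

Definition seg a b (t : R) : plane :=
  (a.1 + t * (b.1 - a.1), a.2 + t * (b.2 - a.2)).

Definition segment a b : set plane := seg a b @` `[0, 1]%classic.

Lemma seg0 a b : seg a b 0 = a.
Proof. by case: a => x y; rewrite /seg /= !mul0r !addr0. Qed.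

Lemma seg1 a b : seg a b 1 = b.
Proof.
by case: a b => x y [z w]; rewrite /seg /= !mul1r; congr pair;
  rewrite addrC subrK.
Qed.

Lemma segmentl a b : segment a b a.
Proof. by exists 0; rewrite ?seg0 //= in_itv /= lexx ler01. Qed.

Lemma segmentr a b : segment a b b.
Proof. by exists 1; rewrite ?seg1 //= in_itv /= lexx ler01. Qed.

Lemma segmentC a b p : segment a b p -> segment b a p.
Proof.
case=> t /= t01 <-; exists (1 - t).
  by move: t01; rewrite /= !in_itv /=; lra.
by rewrite /seg; congr pair; ring.
Qed.

Lemma seg_inj a b : a <> b -> injective (seg a b).
Proof.
move=> ab s t [/addrI e1 /addrI e2]; apply/eqP; case: (eqVneq s t) => // st.
case: ab; case: a b e1 e2 => x y [z w] /= e1 e2.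
have inj u : s * u = t * u -> u = 0.
  move/eqP; rewrite -subr_eq0 -mulrBl mulf_eq0 subr_eq0 (negbTE st) /=.
  by move/eqP.
by congr pair; apply/esym/eqP; rewrite -subr_eq0; apply/eqP/inj.
Qed.

Lemma affine_continuous (x y : R) : continuous (fun t : R => x + t * y).
Proof.
move=> t; apply: cvgD; first exact: cvg_cst.
by apply: cvgM; [exact: cvg_id|exact: cvg_cst].
Qed.

Lemma seg_continuous a b : continuous (seg a b).
Proof.
move=> t; set p := seg a b t.
apply: (@cvg_pair _ _ _ (nbhs t) (nbhs p.1) (nbhs p.2));
  exact: affine_continuous.
Qed.

Lemma cross_seg a b c d t :
  cross a b (seg c d t) = (1 - t) * cross a b c + t * cross a b d.
Proof. by rewrite /cross /seg /=; ring. Qed.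

Lemma fan_disjoint o a b p :
  fan o a b -> segment o a p -> segment o b p -> p = o.
Proof.
move=> oab [t /= t01 <-] [s /= s01].
case: o a b oab => ox oy [ax ay] [bx by_].
rewrite /seg /= => oab [e1 e2].
have e1' : s * (bx - ox) = t * (ax - ox) by lra.
have e2' : s * (by_ - oy) = t * (ay - oy) by lra.
suff -> : t = 0 by rewrite !mul0r !addr0.
move: t01 s01; rewrite !in_itv /= => /andP[t0 _] /andP[s0 _].
case/orP: oab => [|]; rewrite /cross /dot /=.
  set k := (X in X != 0) => k0.
  suff : t * k = 0 by move/eqP; rewrite mulf_eq0 (negbTE k0) orbF => /eqP.
  have -> : t * k = (t * (ax - ox)) * (by_ - oy) - (t * (ay - oy)) * (bx - ox).
    by rewrite /k; ring.
  by rewrite -e1' -e2'; ring.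
(* The dot product of t (a - o) = s (b - o) with b - o is at most 0 on the left
   and at least 0 on the right, so it vanishes, and t = 0. *)
set k := (X in X < 0) => k0.
have : t * k = s * ((bx - ox) ^+ 2 + (by_ - oy) ^+ 2).
  have -> : t * k = (t * (ax - ox)) * (bx - ox) + (t * (ay - oy)) * (by_ - oy).
    by rewrite /k; ring.
  by rewrite -e1' -e2'; ring.
have := mulr_ge0 s0 (addr_ge0 (sqr_ge0 (bx - ox)) (sqr_ge0 (by_ - oy))).
by move=> h e; apply/eqP; rewrite eq_le t0 andbT -(nmulr_lge0 _ k0) e.
Qed.

Lemma line_misses_segment a b c d t :
  0 < cross a b c * cross a b d -> 0 <= t <= 1 -> cross a b (seg c d t) != 0.
Proof.
move=> k /andP[t0 t1]; rewrite cross_seg; apply/eqP => e.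
set u := cross a b c in k e; set v := cross a b d in k e.
have u0 : 0 < u ^+ 2 
  by rewrite exprn_even_gt0 //=; apply: contraTneq k => ->; rewrite mul0r ltxx.
have : (1 - t) * u ^+ 2 + t * (u * v) = 0.
  by rewrite -[RHS](mul0r u) -e; ring.
have h1 : 0 <= (1 - t) * u ^+ 2 by rewrite mulr_ge0 ?subr_ge0 // ltW.
have h2 : 0 <= t * (u * v) by rewrite mulr_ge0 // ltW.
move=> e2; have /eqP : (1 - t) * u ^+ 2 = 0 by lra.
rewrite mulf_eq0 (gt_eqF u0) orbF subr_eq0 => /eqP t1'.
by move: e2; rewrite -t1' subrr mul0r mul1r add0r => k0; rewrite k0 ltxx in k.
Qed.

Lemma cross_on_line a b t : cross a b (seg a b t) = 0.
Proof. by rewrite /cross /seg /=; ring. Qed.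

Lemma split_disjoint a b c d p :
  split_by_line a b c d -> segment a b p -> segment c d p -> False.
Proof.
rewrite /segment => /orP[] k [t /= + <-] [s /= + e];
  rewrite !in_itv /= => t01 s01.
  move/eqP: (line_misses_segment k s01); rewrite e; apply.
  exact: cross_on_line.
move/eqP: (line_misses_segment k t01); rewrite -e; apply.
exact: cross_on_line.
Qed.

End Segments.

(** * Embeddings from half-edges *)

Section Drawings.
Local Open Scope classical_set_scope.
Local Open Scope ring_scope.
Variable R : realType.
Notation plane := (R * R)%type.

(** Both curves run towards their common endpoint, as the two halves of an
    edge do when each is drawn from its own vertex; the second one is
    traversed backwards. *)
Lemma simple_arc_join (T : topologicalType) (f g : R -> T) :
  continuous f -> continuous g ->
  {in `[0, 1] &, injective f} -> {in `[0, 1] &, injective g} ->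
  f 1 = g 1 ->
  (forall s t, s \in `[0, 1] -> t \in `[0, 1] -> f s = g t -> s = 1 /\ t = 1) ->
  simple_arc R (f @` `[0, 1] `|` g @` `[0, 1]) (f 0) (g 0).
Proof.
move=> fc gc fi gi fg fg1.
pose h t := if t <= 2^-1 then f (2 * t) else g (2 - 2 * t).
have lo (t : R) : t \in `[0, 1] -> t <= 2^-1 -> 2 * t \in `[0, 1].
  by rewrite !in_itv /= => /andP[? ?] ?; lra.
have hi (t : R) : t \in `[0, 1] -> ~~ (t <= 2^-1) -> 2 - 2 * t \in `[0, 1].
  by rewrite !in_itv /= -ltNge => /andP[? ?] ?; lra.
exists h; split.
- have -> : `[0, 1]%classic = `[0, 2^-1] `|` `[2^-1, 1] :> set R.
    apply/seteqP; split=> t /=; rewrite !in_itv /=.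
      move=> /andP[t0 t1]; case: (leP t 2^-1) => th; [left|right]; lra.
    by case=> /andP[? ?]; lra.
  apply: withinU_continuous; [exact: interval_closed|exact: interval_closed| |].
  + apply: (@subspace_eq_continuous _ _ _
      (from_subspace `[0, 2^-1]%classic (fun t => f (2 * t)))).
      by move=> t; rewrite inE /= in_itv /= /from_subspace /h => /andP[_ ->].
    apply: continuous_subspaceT => t; apply: continuous_comp; last exact: fc.
    by apply: cvgM; [exact: cvg_cst|exact: cvg_id].
  + apply: (@subspace_eq_continuous _ _ _
      (from_subspace `[2^-1, 1]%classic (fun t => g (2 - 2 * t)))).
      move=> t; rewrite inE /= in_itv /= /from_subspace /h => /andP[t0 t1].
      case: ifP => // t2; have -> : t = 2^-1 by lra.
      by rewrite mulfV // [2 - 1](_ : _ = 1) //; lra.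
    apply: continuous_subspaceT => t; apply: continuous_comp; last exact: gc.
    apply: cvgB; first exact: cvg_cst.
    by apply: cvgM; [exact: cvg_cst|exact: cvg_id].
- move=> s t si ti; rewrite /h; case: ifPn => s2; case: ifPn => t2.
  + by move/(fi _ _ (lo _ si s2) (lo _ ti t2)); lra.
  + case/(fg1 _ _ (lo _ si s2) (hi _ ti t2)) => *.
    by move: t2; rewrite -ltNge => t2; lra.
  + move/esym; case/(fg1 _ _ (lo _ ti t2) (hi _ si s2)) => *.
    by move: s2; rewrite -ltNge => s2; lra.
  + by move/(gi _ _ (hi _ si s2) (hi _ ti t2)); lra.
- by rewrite /h invr_ge0 ler0n mulr0.
- rewrite /h ifF; last by apply/negbTE; rewrite -ltNge; lra.
  by congr g; lra.
- apply/seteqP; split=> x /=.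
    case=> t ti <-; rewrite /h; case: ifPn => th; [left|right].
      by exists (2 * t) => //; exact: lo.
    by exists (2 - 2 * t) => //; exact: hi.
  case=> -[t + <-]; rewrite in_itv /= => /andP[t0 t1].
    exists (t / 2); first by rewrite in_itv /=; lra.
    rewrite /h ifT; last lra.
    by congr f; lra.
  exists (1 - t / 2); first by rewrite in_itv /=; lra.
  rewrite /h; case: ifPn => th; last by congr g; lra.
  have -> : t = 1 by lra.
  by rewrite -fg; congr f; lra.
Qed.

(** Precomposition with this retraction makes a path defined on the unit
    interval continuous on the whole line, which spares subspace topologies. *)
Definition clamp (t : R) : R := Num.max 0 (Num.min 1 t).

Lemma clamp_continuous : continuous clamp.
Proof.
move=> t; apply: continuous_max; first exact: cvg_cst.
by apply: continuous_min; [exact: cvg_cst|exact: cvg_id].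
Qed.

Lemma clamp_itv t : clamp t \in `[0, 1].
Proof. by rewrite in_itv /= /clamp le_max lexx ge_max ler01 ge_min lexx. Qed.

Lemma clamp_id t : t \in `[0, 1] -> clamp t = t.
Proof.
by rewrite in_itv /= => /andP[t0 t1];
  rewrite /clamp (min_idPr t1) (max_idPr t0).
Qed.

Section Embedding.
Variables (T : topologicalType) (D : set plane) (q : plane -> T).
Variable r : plane -> plane -> Prop.
Hypothesis q_continuous : forall f : R -> plane,
  continuous f -> (forall t, D (f t)) -> continuous (q \o f).
Hypothesis qE : forall a b, D a -> D b -> (q a = q b <-> r a b).

Variables (V : finType) (e : rel V) (pos : V -> plane) (mid : V -> V -> plane).
Hypothesis e_sym : symmetric e.
Hypothesis e_irr : irreflexive e.
Hypothesis e_deg : forall u, exists v, e u v.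
Hypothesis half_proper : forall u v, e u v -> pos u <> mid u v.
Hypothesis half_sub : forall u v, e u v -> segment (pos u) (mid u v) `<=` D.
Hypothesis half_glue : forall u v, e u v -> r (mid u v) (mid v u).
Hypothesis half_cross : forall u v u' v' a b, e u v -> e u' v' ->
  segment (pos u) (mid u v) a -> segment (pos u') (mid u' v') b -> r a b ->
  [\/ [/\ u = u', v = v' & a = b],
      [/\ u' = v, v' = u, a = mid u v & b = mid v u] |
      [/\ u = u', a = pos u & b = pos u]].

Let half u v : set T := q @` segment (pos u) (mid u v).

Let half_path u v (t : R) : T := q (seg (pos u) (mid u v) (clamp t)).

Let half_pathE u v t : t \in `[0, 1] ->
  half_path u v t = q (seg (pos u) (mid u v) t).
Proof. by move=> ti; rewrite /half_path clamp_id. Qed.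

Let seg_segment (a b : plane) t : t \in `[0, 1] -> segment a b (seg a b t).
Proof. by exists t. Qed.

Let half_path_continuous u v : e u v -> continuous (half_path u v).
Proof.
move=> uv; apply: q_continuous.
  move=> t; apply: continuous_comp; first exact: clamp_continuous.
  exact: seg_continuous.
by move=> t; apply: (half_sub uv); apply: seg_segment; exact: clamp_itv.
Qed.

Let half_path_image u v : half_path u v @` `[0, 1] = half u v.
Proof.
apply/seteqP; split=> x /=.
  case=> t ti <-; exists (seg (pos u) (mid u v) t); rewrite ?half_pathE //.
  by exists t.
by case=> _ [t ti <-] <-; exists t; rewrite ?half_pathE.
Qed.

Let half_path_inj u v : e u v -> {in `[0, 1] &, injective (half_path u v)}.
Proof.
move=> uv s t si ti; rewrite !half_pathE //.
have ss := seg_segment (pos u) (mid u v) si.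
have st := seg_segment (pos u) (mid u v) ti.
move/(qE (half_sub uv ss) (half_sub uv st)) => st'.
apply: (seg_inj (half_proper uv)).
by case: (half_cross uv uv ss st st') => [[]//|[-> _ -> ->]//|[_ -> ->]].
Qed.

Let half_cases u v u' v' x : e u v -> e u' v' -> half u v x -> half u' v' x ->
  [\/ u = u' /\ v = v', [/\ u' = v, v' = u & x = q (mid u v)] |
      u = u' /\ x = q (pos u)].
Proof.
move=> uv uv' [a ha <-] [b hb] /esym ab.
have {}ab := (qE (half_sub uv ha) (half_sub uv' hb)).1 ab.
case: (half_cross uv uv' ha hb ab) => [[-> -> _]|[-> -> -> _]|[-> -> _]].
- exact: Or31.
- exact: Or32.
- exact: Or33.
Qed.

Let half_vertex u v w : e u v -> half u v (q (pos w)) -> w = u.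
Proof.
move=> uv [a ha aw]; have [w' ww] := e_deg w.
have hw := segmentl (pos w) (mid w w').
have aw' := (qE (half_sub uv ha) (half_sub ww hw)).1 aw.
case: (half_cross uv ww ha hw aw') => [[->]//|[wv w'u _ wm]|[->]//].
by case: (half_proper ww); rewrite wm wv w'u.
Qed.

Let half_mid u v : e u v -> q (mid u v) = q (mid v u).
Proof.
move=> uv; have vu : e v u by rewrite e_sym.
apply/(qE (half_sub uv (segmentr _ _)) (half_sub vu (segmentr _ _))).
exact: half_glue.
Qed.

(** An edge [u v] is drawn as the two half-edges from [pos u] to [mid u v]
    and from [pos v] to [mid v u], whose far ends have the same image in [T]:
    they may be two different points of the plane, which is how an edge goes
    through a handle or a cross-cap. If half-edges meet in [T] only where
    they must, the images of the edges embed the graph. *)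
Lemma drawing_embeddable : embeddable R e T.
Proof.
exists (q \o pos), (fun u v => half u v `|` half v u); split.
- move=> u w /= uw; have [v uv] := e_deg u.
  apply/esym/(half_vertex uv); rewrite -uw; exists (pos u) => //.
  exact: segmentl.
- by move=> u v; rewrite setUC.
- move=> u v uv; have vu : e v u by rewrite e_sym.
  rewrite -!half_path_image.
  have zi : 0 \in `[0, 1 : R] by rewrite in_itv /= lexx ler01.
  have oi : 1 \in `[0, 1 : R] by rewrite in_itv /= lexx ler01.
  have p0 a b : half_path a b 0 = (q \o pos) a by rewrite half_pathE // seg0.
  have p1 a b : half_path a b 1 = q (mid a b) by rewrite half_pathE // seg1.
  rewrite -(p0 u v) -(p0 v u); apply: simple_arc_join.
  + exact: half_path_continuous.
  + exact: half_path_continuous.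
  + exact: half_path_inj.
  + exact: half_path_inj.
  + by rewrite !p1 half_mid.
  + move=> s t si ti; rewrite !half_pathE // => st.
    have ss := seg_segment (pos u) (mid u v) si.
    have tt := seg_segment (pos v) (mid v u) ti.
    have {}st := (qE (half_sub uv ss) (half_sub vu tt)).1 st.
    have uv_neq : u <> v by move=> uv'; move: uv; rewrite uv' e_irr.
    case: (half_cross uv vu ss tt st) => [[]//|[_ _ e1 e2]|[]//].
    by split; [apply: (seg_inj (half_proper uv))|
               apply: (seg_inj (half_proper vu))]; rewrite seg1.
- move=> u v uv; have vu : e v u by rewrite e_sym.
  apply/seteqP; split=> // x [[h ends] [w _ /= wx]]; apply: ends.
  by case: h; rewrite -wx => hw; rewrite (half_vertex _ hw) //; [left|right].
- move=> u v u' v' uv uv' neq; have vu : e v u by rewrite e_sym.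
  have vu' : e v' u' by rewrite e_sym.
  apply/seteqP; split=> // x [[h ends] h']; apply: ends.
  have neq' : [set v; u]%SET != [set u'; v']%SET by rewrite finset.setUC.
  have start a b a' b' : e a b -> e a' b' ->
      [set a; b]%SET != [set a'; b']%SET ->
      half a b x -> half a' b' x -> x = q (pos a).
    move=> ab ab' ne ha ha'.
    case: (half_cases ab ab' ha ha') => [[aa bb]|[ab'' ba _]|[]//].
      by move: ne; rewrite aa bb eqxx.
    by move: ne; rewrite ab'' ba finset.setUC eqxx.
  by case: h => h; [left|right]; case: h' => h';
    apply: (start _ _ _ _ _ _ _ h h') => //;
    rewrite (finset.setUC [set v']%SET).
Qed.

End Embedding.
End Drawings.

(** * Charts of glued spheres *)

Section GluedSpheres.
Local Open Scope classical_set_scope.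
Local Open Scope ring_scope.
Variable R : realType.
Notation plane := (R * R)%type.

Section Chart.
Variables (C : set plane) (r : plane -> plane -> Prop).
Hypotheses (r_refl : forall p, r p p) (r_sym : forall p q, r p q -> r q p).
Hypothesis r_trans : forall p q s, r p q -> r q s -> r p s.

Definition off_holes : set plane := Some @^-1` perforated_sphere C.

Let S := glued_sphere C r_refl r_sym r_trans.

Let infinity_perforated : perforated_sphere C None.
Proof. by case. Qed.

Let lift (p : plane) : perforated_sphere C :=
  match pselect (off_holes p) with
  | left h => exist _ (Some p) (mem_set h)
  | right _ => exist _ None (mem_set infinity_perforated)
  end.

(** Points inside a hole are sent to the point at infinity, which makes the
    map total. *)
Definition chart (p : plane) : S := \pi_S%qT (lift p).

Let liftE p : off_holes p -> set_val (lift p) = Some p.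
Proof. by rewrite /lift; case: pselect. Qed.

Lemma chartE p q : off_holes p -> off_holes q -> chart p = chart q <-> r p q.
Proof.
move=> hp hq; rewrite /chart.
have E := @eqmodP _ (glue_equiv C r_refl r_sym r_trans) (lift p) (lift q).
split=> [/E /asboolP|pq]; first by rewrite !liftE.
by apply/E/asboolP; rewrite !liftE.
Qed.

Lemma chart_continuous (f : R -> plane) :
  continuous f -> (forall t, off_holes (f t)) -> continuous (chart \o f).
Proof.
move=> fc fD t; apply: (@continuous_comp _ _ _ (lift \o f) \pi_S%qT);
  last exact: pi_continuous.
apply: continuous_comp_initial => {}t.
have -> : set_val \o (lift \o f) = Some \o f.
  by apply/funext => s /=; rewrite liftE.
apply: continuous_comp; first exact: fc.
exact: one_point_compactification_some_continuous.
Qed.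

End Chart.

Lemma embeddable_homeomorphic (V : finType) (e : rel V)
    (S T : topologicalType) :
  homeomorphic S T -> embeddable R e T -> embeddable R e S.
Proof.
move=> [f [g [fK gK fc gc]]] [p [A [pi Asym Aarc Ap AA]]].
have gi : injective g by exact: can_inj gK.
exists (g \o p), (fun u v => g @` A u v); split.
- exact: inj_comp.
- by move=> u v; rewrite Asym.
- move=> u v /Aarc[gamma [gammac gammai g0 g1 <-]].
  exists (g \o gamma); split.
  + by apply: within_continuous_comp => // t _; exact: gc.
  + by move=> s t si ti /gi; exact: gammai.
  + by rewrite /= g0.
  + by rewrite /= g1.
  + by rewrite image_comp.
- move=> u v uv; apply/seteqP; split=> // _ [[[x xA <-] ends] [w _ /gi wx]].
  suff : ((A u v `\` [set p u; p v]) `&` range p) x by rewrite Ap.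
  split; last by exists w.
  by split=> // -[] xE; apply: ends; rewrite xE; [left|right].
- move=> u v u' v' uv uv' ne.
  apply/seteqP; split=> // _ [[[x xA <-] ends] [y yA /gi yx]].
  suff : ((A u v `\` [set p u; p v]) `&` A u' v') x by rewrite AA.
  split; last by rewrite -yx.
  by split=> // -[] xE; apply: ends; rewrite xE; [left|right].
Qed.

End GluedSpheres.

(** * Holes and the integer grid *)

Section Holes.
Variable A : realDomainType.
Implicit Types c a m : A * A.

(** A coordinate half-plane contains the segment [a m] and misses the open
    square of centre [c] and half side [rho]; the closed square can be
    touched at [m] only. *)
Definition clear (rho : A) c a m : bool :=
  [|| (c.1 + rho < a.1) && (c.1 + rho <= m.1),
      (a.1 < c.1 - rho) && (m.1 <= c.1 - rho),
      (c.2 + rho < a.2) && (c.2 + rho <= m.2) |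
      (a.2 < c.2 - rho) && (m.2 <= c.2 - rho)].

Definition rim (rho : A) c m : bool :=
  Num.max `|m.1 - c.1| `|m.2 - c.2| == rho.

End Holes.

Section ClearReal.
Variable R : realType.
Notation plane := (R * R)%type.

Lemma clear_segment (c a m p : plane) :
  clear 1 c a m -> segment a m p -> 1 <= `|p - c| /\ (`|p - c| = 1 -> p = m).
Proof.
move=> cam [t /= + <-]; rewrite in_itv /= prod_normE => /andP[t0 t1].
have [->|t1'] := eqVneq t 1.
  rewrite seg1; split=> //; rewrite le_max /=.
  by case/or4P: cam => /andP[h1 h2]; rewrite !ler_normr; lra.
have {t1} t1 : t < 1 by rewrite lt_neqAle t1'.
suff h : 1 < Num.max `|(seg a m t - c).1| `|(seg a m t - c).2|.
  by split; [exact: ltW|move=> e; rewrite e ltxx in h].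
rewrite lt_max !ltr_normr /seg /=.
by case/or4P: cam => /andP[h1 h2]; nra.
Qed.

Lemma not_ball (c p : plane) : 1 <= `|p - c| -> ~ ball c (1 : R) p.
Proof. by rewrite -ball_normE /= distrC leNgt => /negP. Qed.

End ClearReal.

Section Grid.
Variable R : realType.
Notation plane := (R * R)%type.

(** Coordinates are counted in tenths, so that all geometric conditions
    become integer computations; the holes then have half side 10. *)
Definition grid (x : Z) : R := (int_of_Z x)%:~R / 10.

Lemma gridD x y : grid (x + y) = grid x + grid y.
Proof. by rewrite /grid rmorphD /= intrD mulrDl. Qed.

Lemma gridN x : grid (- x) = - grid x.
Proof. by rewrite /grid rmorphN /= mulrNz mulNr. Qed.

Lemma gridB x y : grid (x - y) = grid x - grid y.
Proof. by rewrite gridD gridN. Qed.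

Lemma grid10 : grid 10 = 1.
Proof. by rewrite /grid -[int_of_Z _]/10%:Z divff // pnatr_eq0. Qed.

Lemma grid20 : grid 20 = 2.
Proof.
by rewrite (_ : Z.pos 20 = Z.pos 10 + Z.pos 10) // gridD grid10; ring.
Qed.

Lemma grid30 : grid 30 = 3.
Proof.
by rewrite (_ : Z.pos 30 = Z.pos 20 + Z.pos 10) // gridD grid20 grid10; ring.
Qed.

Lemma grid0 : grid 0 = 0.
Proof. by rewrite /grid /= mul0r. Qed.

Lemma gridM x y : grid (x * y) = 10 * (grid x * grid y).
Proof. by rewrite /grid rmorphM /= intrM; field. Qed.

Lemma le_grid x y : (grid x <= grid y) = (x <= y).
Proof.
rewrite /grid ler_pM2r ?invr_gt0 ?ltr0n // ler_int; lia.
Qed.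

Lemma lt_grid x y : (grid x < grid y) = (x < y).
Proof. by rewrite !ltNge le_grid. Qed.

Lemma eq_grid x y : (grid x == grid y) = (x == y).
Proof. by rewrite !eq_le !le_grid. Qed.

Lemma grid_norm x : grid `|x| = `|grid x|.
Proof.
have [x0|x0] := leP 0 x; first by rewrite !ger0_norm // -grid0 le_grid.
by rewrite !ltr0_norm ?gridN // -grid0 lt_grid.
Qed.

Lemma grid_max x y : grid (Num.max x y) = Num.max (grid x) (grid y).
Proof. by rewrite !maxElt lt_grid; case: ifP. Qed.

Definition gpt (z : Z * Z) : plane := (grid z.1, grid z.2).

Lemma gpt_inj : injective gpt.
Proof.
by move=> [x y] [z w] [/eqP + /eqP]; rewrite !eq_grid => /eqP -> /eqP ->.
Qed.

Lemma gpt0 : gpt 0 = 0.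
Proof. by rewrite /gpt /= grid0. Qed.

Lemma gptN z : gpt (- z) = - gpt z.
Proof. by rewrite /gpt /= !gridN. Qed.

Lemma cross_gpt o a b : cross (gpt o) (gpt a) (gpt b) = grid (cross o a b) / 10.
Proof. by rewrite /cross gridB !gridM !gridB /=; field. Qed.

Lemma dot_gpt o a b : dot (gpt o) (gpt a) (gpt b) = grid (dot o a b) / 10.
Proof. by rewrite /dot gridD !gridM !gridB /=; field. Qed.

Lemma fan_gpt o a b : fan (gpt o) (gpt a) (gpt b) = fan o a b.
Proof.
rewrite /fan cross_gpt dot_gpt mulf_eq0 invr_eq0 pnatr_eq0 orbF.
by rewrite pmulr_llt0 ?invr_gt0 ?ltr0n // -grid0 eq_grid lt_grid.
Qed.

Lemma split_by_line_gpt a b c d :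
  split_by_line (gpt a) (gpt b) (gpt c) (gpt d) = split_by_line a b c d.
Proof.
have E x y : (0 < grid x / 10 * (grid y / 10)) = (0 < x * y).
  rewrite -[RHS]lt_grid grid0 gridM.
  have -> : grid x / 10 * (grid y / 10) =
            10 * (grid x * grid y) * 10^-1 ^+ 3 by field.
  by rewrite pmulr_lgt0 // exprn_gt0 // invr_gt0 ltr0n.
by rewrite /split_by_line !cross_gpt !E.
Qed.

Lemma clear_gpt c a m : clear 1 (gpt c) (gpt a) (gpt m) = clear 10 c a m.
Proof. by rewrite /clear /= -grid10 -!gridD -!gridB !lt_grid !le_grid. Qed.

Lemma rim_gpt c m : (`|gpt m - gpt c| == 1) = rim 10 c m.
Proof.
by rewrite prod_normE /= -!gridB -!grid_norm -grid_max -grid10 eq_grid.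
Qed.

End Grid.

(** * Two drawings in integer coordinates *)

Section Coordinates.
Local Open Scope Z_scope.

(** The pentagon [0, ..., 4] surrounds the holes centred on the axis [x = 0]
    and the apex [5] lies far to the left. The last triples are the inner
    triangles of the gadgets. *)
Definition positions : seq (Z * Z) :=
  [:: (-40, 5); (12, 60); (20, 0); (0, -80); (-40, -5); (-200, 40);
      (7, 154); (15, 164); (13, 80); (-37, -20); (-84, 4); (-53, -29);
      (-95, 14); (-59, 7); (-46, 2)].

Definition waypoints : Type := seq (nat * nat * ((Z * Z) * (Z * Z))).

(** The edge [u v] goes straight from [u] to [m] and from [m'] to [v], where
    [m] and [m'] are equal or glued together. *)
Definition way (u v : nat) (m m' : Z * Z) := (u, v, (m, m')).

(** The bends of four of these edges make each half-edge lie, for each hole,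
    on the other side of a horizontal or vertical line. The edge from [5] to
    [2] passes above everything else, so that all the holes at [x >= 3] lie
    in the face of [5, 2, 3], together with the point at infinity. *)
Definition planar_waypoints : waypoints :=
  [:: way 0 1 (-12, 36) (-12, 36); way 2 3 (11, -36) (11, -36);
      way 3 4 (-20, -42) (-20, -42); way 5 2 (25, 200) (25, 200);
      way 3 5 (-20, -70) (-20, -70)].

(** The five chords of the pentagon all go through the cross-cap, entering
    and leaving at antipodal points of its rim. *)
Definition crosscap_waypoints : waypoints :=
  [:: way 0 2 (-10, 0) (10, 0); way 3 0 (10, -10) (-10, 10);
      way 1 3 (0, 10) (0, -10); way 4 1 (-10, -10) (10, 10);
      way 2 4 (10, 5) (-10, -5)] ++ planar_waypoints.

(** Two chords run between the two holes. The other three each separate the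
    ends of one of them, or of both, on the pentagon, so that they have to go
    through the handle; they enter and leave it at mirror points of the rims. *)
Definition handle_waypoints : waypoints :=
  [:: way 0 2 (0, 2) (0, 2); way 2 4 (0, -2) (0, -2);
      way 1 3 (0, 30) (0, -30); way 3 0 (-10, -30) (-10, 30);
      way 4 1 (10, -10) (10, 10)] ++ planar_waypoints.

Definition posZ (u : nat) : Z * Z := nth (0, 0) positions u.

(** An edge without waypoint is straight; the rounding of its midpoint to the
    grid is harmless, since the resulting polygonal line is what gets
    checked. *)
Fixpoint midZ (w : waypoints) (u v : nat) : Z * Z :=
  if w is (a, b, (m, m')) :: w' then
    if (u == a) && (v == b) then m else
    if (u == b) && (v == a) then m' else midZ w' u v
  else let: (x, y) := posZ u in let: (x', y') := posZ v in
       ((x + x') / 2, (y + y') / 2).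

End Coordinates.

Section Checks.
Variable w : waypoints.
Implicit Types h : nat * nat.

Definition half_ends h := (posZ h.1, midZ w h.1 h.2).

Definition swap h := (h.2, h.1).

(** Two half-edges may share their vertex, or the unglued middle of their
    edge, and nothing else. *)
Definition compatible h h' : bool :=
  let: (a, m) := half_ends h in let: (a', m') := half_ends h' in
  if h.1 == h'.1 then (h.2 == h'.2) || fan a m m'
  else if (h' == swap h) && (m == m') then fan m a a'
  else split_by_line a m a' m'.

Definition drawing_ok : bool :=
  all (fun h => (posZ h.1 != midZ w h.1 h.2) &&
    all (compatible h) half_edges) half_edges.

Definition left_of (x : Z) : bool :=
  all (fun h => ((posZ h.1).1 < x) && ((midZ w h.1 h.2).1 < x)) half_edges.

Definition avoids (c : Z * Z) : bool :=
  all (fun h => clear 10 c (posZ h.1) (midZ w h.1 h.2)) half_edges.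

(** The two middles of an edge are equal or glued, and no other half-edge
    ends at a point glued to one of them. *)
Definition glued_ok (glue : rel (Z * Z)) : bool :=
  all (fun h => let m := midZ w h.1 h.2 in let m' := midZ w h.2 h.1 in
    ((m == m') || glue m m') &&
    all (fun h' => glue m (midZ w h'.1 h'.2) ==> (h' == swap h)) half_edges)
  half_edges.

End Checks.

(** The gluing along the rim of the hole centred at the origin. It is the
    whole gluing among points with [x < 3], which the other holes do not
    reach. *)
Definition crosscap_glue : rel (Z * Z) :=
  fun m m' => rim 10 0 m && (m' == - m).

(** As for the cross-cap, this is the whole gluing among points with [x < 3]. *)
Definition handle_glue : rel (Z * Z) := fun m m' =>
  (rim 10 (0, 20) m || rim 10 (0, -20) m) && (m' == (m.1, - m.2)).

Lemma crosscap_drawing_ok : drawing_ok crosscap_waypoints.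
Proof. by vm_compute. Qed.

Lemma handle_drawing_ok : drawing_ok handle_waypoints.
Proof. by vm_compute. Qed.

Lemma crosscap_left : left_of crosscap_waypoints 30.
Proof. by vm_compute. Qed.

Lemma handle_left : left_of handle_waypoints 30.
Proof. by vm_compute. Qed.

Lemma crosscap_avoids : avoids crosscap_waypoints 0.
Proof. by vm_compute. Qed.

Lemma handle_avoids (b : bool) :
  avoids handle_waypoints (0, if b then 20 else - 20).
Proof. by case: b; vm_compute. Qed.

Lemma crosscap_glued_ok : glued_ok crosscap_waypoints crosscap_glue.
Proof. by vm_compute. Qed.

Lemma handle_glued_ok : glued_ok handle_waypoints handle_glue.
Proof. by vm_compute. Qed.

(** * From checked coordinates to embeddings *)

Section Soundness.
Local Open Scope classical_set_scope.
Local Open Scope ring_scope.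
Variable R : realType.
Notation plane := (R * R)%type.
Notation gpt := (@gpt R).

Variable w : waypoints.
Hypothesis w_ok : drawing_ok w.
Hypothesis w_left : left_of w 30.

Let V := 'I_15.
Let e : rel V := underlying arc15.
Let pos (u : V) : plane := gpt (posZ u).
Let mid (u v : V) : plane := gpt (midZ w u v).

Let e_half_edge u v : e u v -> (val u, val v) \in half_edges.
Proof. by rewrite /e underlying15. Qed.

Let e_irr : irreflexive e.
Proof.
move=> u; apply/negP => /e_half_edge.
have /allP H : all (fun h => h.1 != h.2) half_edges by vm_compute.
by move/H; rewrite eqxx.
Qed.

Let e_deg u : exists v, e u v.
Proof.
have /allP H : all (fun n => has (fun m => (n, m) \in half_edges) (iota 0 15))
                   (iota 0 15).
  by vm_compute.
have /H /hasP[m] : val u \in iota 0 15 by rewrite mem_iota /=.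
rewrite mem_iota /= => m15 um; exists (Ordinal m15).
by rewrite /e underlying15.
Qed.

Let half_proper u v : e u v -> pos u <> mid u v.
Proof.
by move=> /e_half_edge uv /gpt_inj; move/allP: w_ok => /(_ _ uv) /andP[/eqP].
Qed.

(** Two half-edges with a common point in the plane pass the compatibility
    test through one of its first two branches. *)
Lemma planar_crossing u v u' v' p : e u v -> e u' v' ->
  segment (pos u) (mid u v) p -> segment (pos u') (mid u' v') p ->
  [\/ u = u' /\ v = v', [/\ u' = v, v' = u, p = mid u v & p = mid v u] |
      u = u' /\ p = pos u].
Proof.
move=> /e_half_edge uv /e_half_edge uv' hp hp'.
have /andP[_ /allP/(_ _ uv')] := allP w_ok _ uv.
rewrite /compatible /=; case: ifP => [/eqP/val_inj uu|_].
  case/orP=> [/eqP/val_inj vv|f]; first exact: Or31.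
  apply: Or33; split=> //; subst u'.
  by apply: (fan_disjoint _ hp hp'); rewrite /pos /mid fan_gpt.
case: ifP => [/andP[/eqP[/val_inj vu /val_inj uv''] /eqP mm] f|_ f].
  subst u' v'; apply: Or32.
  suff -> : p = mid u v by split=> //; rewrite /mid mm.
  have f' : fan (mid u v) (pos u) (pos v) by rewrite /pos /mid fan_gpt.
  apply: (fan_disjoint f'); first exact: segmentC.
  by apply: segmentC; rewrite /mid mm.
by case: (@split_disjoint R (pos u) (mid u v) (pos u') (mid u' v') p) => //;
  rewrite split_by_line_gpt.
Qed.

Section Glue.
Variables (C : set plane) (r : plane -> plane -> Prop).
Hypotheses (r_refl : forall p, r p p) (r_sym : forall p q, r p q -> r q p).
Hypothesis r_trans : forall p q s, r p q -> r q s -> r p s.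
Variable glue : rel (Z * Z).
Hypothesis C_avoid : forall c, C c ->
  4 <= c.1 \/ exists2 z, c = gpt z & avoids w z.
Hypothesis r_rim : forall p q, r p q -> p = q \/
  exists2 c, C c & `|p - c| = 1.
Hypothesis r_glue : forall m m' : Z * Z,
  m.1 < 30 -> r (gpt m) (gpt m') -> m = m' \/ glue m m'.
Hypothesis glue_r : forall m m' : Z * Z, glue m m' -> r (gpt m) (gpt m').
Hypothesis glued : glued_ok w glue.

Let e_sym : symmetric e.
Proof. by move=> u v; rewrite /e /underlying orbC. Qed.

Let clear_hole u v c : e u v -> C c -> clear 1 c (pos u) (mid u v).
Proof.
move=> /e_half_edge uv /C_avoid[c4|[z -> /allP/(_ _ uv)]];
  last by rewrite clear_gpt.
have /andP[l1 l2] := allP w_left _ uv.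
move: l1 l2; rewrite -!(lt_grid R) grid30 /clear /= => l1 l2.
by apply/or4P/Or42/andP; split; lra.
Qed.

Let half_sub u v : e u v -> segment (pos u) (mid u v) `<=` off_holes C.
Proof.
move=> uv p hp /= [x [c cC xc] [xp]].
have [pc _] := clear_segment (clear_hole uv cC) hp.
by apply: (not_ball pc); rewrite -xp.
Qed.

Let half_glue u v : e u v -> r (mid u v) (mid v u).
Proof.
move=> /e_half_edge uv; have /andP[/orP[/eqP h|h] _] := allP glued _ uv.
  by rewrite /mid h.
exact: glue_r.
Qed.

Let rim_mid u v c p : e u v -> C c -> segment (pos u) (mid u v) p ->
  `|p - c| = 1 -> p = mid u v.
Proof. by move=> uv cC hp; case: (clear_segment (clear_hole uv cC) hp). Qed.

Let half_cross u v u' v' a b : e u v -> e u' v' ->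
  segment (pos u) (mid u v) a -> segment (pos u') (mid u' v') b -> r a b ->
  [\/ [/\ u = u', v = v' & a = b],
      [/\ u' = v, v' = u, a = mid u v & b = mid v u] |
      [/\ u = u', a = pos u & b = pos u]].
Proof.
move=> uv uv' ha hb ab.
have [E|neq] := pselect (a = b).
  move: hb; rewrite -E => hb.
  by case: (planar_crossing uv uv' ha hb) => [[-> ->]|[-> -> am bm]|[-> ->]];
    [exact: Or31|exact: Or32|exact: Or33].
case: (r_rim ab) => [//|[c cC ac]].
case: (r_rim (r_sym ab)) => [/esym//|[d dC bd]].
have am := rim_mid uv cC ha ac; have bm := rim_mid uv' dC hb bd.
have /andP[_ l] := allP w_left _ (e_half_edge uv).
move: (ab); rewrite am bm => /(r_glue l)[mm|g].
  by case: neq; rewrite am bm /mid mm.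
have /andP[_ /allP/(_ _ (e_half_edge uv'))] := allP glued _ (e_half_edge uv).
rewrite g /= => /eqP[/val_inj vu /val_inj uv''].
by apply: Or32; rewrite vu uv''.
Qed.

(** Off the rims the gluing is trivial, and a half-edge meets a rim at most
    at its middle. So any meeting of half-edges in the surface is either a
    meeting in the plane or the gluing of two middles, and the checks on the
    coordinates cover both cases. *)
Lemma drawing_on_glued_sphere :
  embeddable R (underlying arc15) (glued_sphere C r_refl r_sym r_trans).
Proof.
have qc (f : R -> plane) : continuous f -> (forall t, off_holes C (f t)) ->
  continuous (chart C r_refl r_sym r_trans \o f) by exact: chart_continuous.
have qE a b : off_holes C a -> off_holes C b ->
  chart C r_refl r_sym r_trans a = chart C r_refl r_sym r_trans b <-> r a b.
  exact: chartE.
exact: (drawing_embeddable qc qE e_sym e_irr e_deg half_proper half_sub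
  half_glue half_cross).
Qed.

End Glue.
End Soundness.

(** * The surfaces with a handle or a cross-cap *)

Section Surfaces.
Variable R : realType.
Notation plane := (R * R)%type.

Lemma far_hole (i : nat) : (0 < i)%N -> 4 <= (4 * i)%:R :> R.
Proof. by move=> i0; rewrite ler_nat leq_pmulr. Qed.

Lemma rim_abscissa (c p : plane) : `|p - c| = 1 -> c.1 - 1 <= p.1.
Proof.
move=> pc; have : `|p.1 - c.1| <= 1 by rewrite -pc prod_normE le_max lexx.
by rewrite ler_norml; lra.
Qed.

Lemma near_rim (m : Z * Z) (c : plane) :
  m.1 < 30 -> 4 <= c.1 -> `|gpt R m - c| = 1 -> False.
Proof.
move=> m30 c4 /rim_abscissa /=.
by move: m30; rewrite -(lt_grid R) grid30; lra.
Qed.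

Lemma hole_center0 : hole_center R 0 = gpt R 0.
Proof. by rewrite /hole_center /gpt /= grid0 muln0. Qed.

Lemma handle_center0 b :
  handle_center R 0 b = gpt R (0, if b then 20 else - 20).
Proof.
rewrite /handle_center /gpt /= muln0 grid0; congr pair.
by case: b; rewrite ?grid20 // gridN grid20.
Qed.

(** The drawing uses only the first cross-cap: the others lie at [x >= 3], to
    the right of all vertices and waypoints. *)
Lemma sphere_with_crosscaps_embeds (k : nat) : (0 < k)%N ->
  embeddable R (underlying arc15) (sphere_with_crosscaps R k).
Proof.
move=> k0.
apply: (@drawing_on_glued_sphere R _ crosscap_drawing_ok crosscap_left
  _ _ _ _ _ crosscap_glue).
- move=> _ [[|i] _ <-]; last by left; exact: far_hole.
  by right; exists 0; [exact: hole_center0|exact: crosscap_avoids].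
- by move=> p q [|[c cC [pc _]]]; [left|right; exists c].
- move=> m m' m30 [/gpt_inj|[_ [[|i] _ <-] [pc pq]]]; first by left.
    right; move: pc pq; rewrite hole_center0 => /eqP.
    rewrite rim_gpt /crosscap_glue => -> /=.
    rewrite gpt0 mul0rn => /eqP.
    by rewrite addrC addr_eq0 -gptN => /eqP /gpt_inj ->.
  by case: (near_rim m30 _ pc); exact: far_hole.
- move=> m m' /andP[m0 /eqP->]; right.
  exists (hole_center R 0); first by exists 0%N.
  rewrite hole_center0; split; first by apply/eqP; rewrite rim_gpt.
  by rewrite gpt0 mul0rn gptN subrr.
- exact: crosscap_glued_ok.
Qed.

(** As for cross-caps: only the first handle is used. *)
Lemma sphere_with_handles_embeds (k : nat) : (0 < k)%N ->
  embeddable R (underlying arc15) (sphere_with_handles R k).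
Proof.
move=> k0.
apply: (@drawing_on_glued_sphere R _ handle_drawing_ok handle_left
  _ _ _ _ _ handle_glue).
- move=> _ [[|i] [b [_ ->]]]; last by left; exact: far_hole.
  right; exists (0, if b then 20 else - 20); first exact: handle_center0.
  exact: handle_avoids.
- by move=> p q [|[c cC [pc _]]]; [left|right; exists c].
- move=> m m' m30 [/gpt_inj|[_ [[|i] [b [_ ->]]] [pc pq]]]; first by left.
    right; move: pc; rewrite handle_center0 => /eqP.
    rewrite rim_gpt /handle_glue => mb.
    have -> : m' = (m.1, - m.2).
      by apply: (@gpt_inj R); rewrite pq /reflect_plane /gpt /= gridN.
    by rewrite eqxx andbT; case: b mb => ->; rewrite ?orbT.
  by case: (near_rim m30 _ pc); exact: far_hole.
- move=> m m' /andP[mb /eqP->]; right.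
  have [b mc] : exists b : bool, rim 10 (0, if b then 20 else - 20) m.
    by case/orP: mb; [exists true|exists false].
  exists (handle_center R 0 b); first by exists 0%N, b.
  rewrite handle_center0; split; first by apply/eqP; rewrite rim_gpt.
  by rewrite /reflect_plane /gpt /= gridN.
- exact: handle_glued_ok.
Qed.

End Surfaces.

Theorem theorem3p2 (R : realType) (Sigma : topologicalType) (chi : int)
    (hSigma : surface_of_euler_char R Sigma chi) (hchi : (chi <= 1)%R) :
  (3%:R%:E <= dichromatic_number R Sigma)%E.
Proof.
have emb : embeddable R (underlying arc15) Sigma.
  case: hSigma => -[k [homeo chiE]]; apply: (embeddable_homeomorphic homeo).
    by apply: sphere_with_handles_embeds; lia.
  by apply: sphere_with_crosscaps_embeds; lia.
apply: le_ereal_inf_tmp => _ [k kcol <-]; rewrite lee_fin ler_nat leqNgt.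
apply/negP => k2; apply: arc15_not_2dicolourable.
by apply: (dicolourable_widen (k := k)) => //; exact: kcol arc15_oriented emb.
Qed.
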